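(* Suppose we are given $k$ separate conditional encryption schemes $\Pi_1,\dots,\Pi_k$ with a common message space $\mathcal M$ for predicates $P_1,\dots,P_k$, and that each $\Pi_i$ is $1-\epsilon_i(\lambda)$-correct and $1-\epsilon_i'(\lambda)$-error detecting. Then the OR-composition $\Pi_{or}$ (described in the context), for the predicate $P_{or}=\bigvee_{i=1}^kP_i$, is $1-\epsilon(\lambda)$-correct and $1-\epsilon'(\lambda)$-error detecting with $$\epsilon(\lambda)=\sum_{i=1}^k\epsilon_i'(\lambda)+\sum_{i=1}^k\epsilon_i(\lambda),\qquad \epsilon'(\lambda)=\sum_{i=1}^k\epsilon_i'(\lambda).$$
   Context: **Conditional encryption.** For a binary predicate $P:\mathcal M\times\mathcal M\to\{0,1\}$, a conditional encryption scheme consists of algorithms $(\mathsf{KeyGen},\mathsf{Enc},\mathsf{CondEnc},\mathsf{Dec})$: $(sk,pk)=\mathsf{KeyGen}(1^\lambda;r)$; $\mathsf{Enc}_{pk}(m_1;r)$ outputs a ciphertext with flag $0$; $\mathsf{CondEnc}_{pk}(c,m_2,m_3;r)$ takes a regular (flag $0$) ciphertext, a control message $m_2$ and a payload message $m_3$ and outputs a ciphertext with flag $1$ (and outputs $\bot$ if the input ciphertext has flag $1$); $\mathsf{Dec}_{sk}$ outputs a message in $\mathcal M$ or $\bot$. *Correctness.* The scheme is $1-\epsilon(\cdot)$-correct if (i) for all coins $r_1,r_2$ and $m\in\mathcal M$, with $(sk,pk)=\mathsf{KeyGen}(1^\lambda;r_1)$, $\mathsf{Dec}_{sk}(\mathsf{Enc}_{pk}(m;r_2))=m$;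 and (ii) for all $r_1,r_2$ and all $m_1,m_2,m_3\in\mathcal M$ with $P(m_1,m_2)=1$, $\Pr_{r_3}[\mathsf{Dec}_{sk}(\mathsf{CondEnc}_{pk}(\mathsf{Enc}_{pk}(m_1;r_2),m_2,m_3;r_3))=m_3]\ge 1-\epsilon(\lambda)$. *Error detection.* The scheme is $1-\epsilon(\cdot)$-error detecting if for all $r_1,r_2$ and all $m_1,m_2,m_3\in\mathcal M$ with $P(m_1,m_2)=0$, with $(sk,pk)=\mathsf{KeyGen}(1^\lambda;r_1)$, $\Pr_{r_3}[\mathsf{Dec}_{sk}(\mathsf{CondEnc}_{pk}(\mathsf{Enc}_{pk}(m_1;r_2),m_2,m_3;r_3))=\bot]\ge 1-\epsilon(\lambda)$. **OR-composition $\Pi_{or}$.** $P_{or}(m_1,m_2)=0$ iff $P_i(m_1,m_2)=0$ for all $i\le k$. - $\mathsf{KeyGen}(1^\lambda)$: run $(sk_i,pk_i)\leftarrow\Pi_i.\mathsf{KeyGen}(1^\lambda)$ for each $i$; $sk=(sk_1,\dots,sk_k)$, $pk=(pk_1,\dots,pk_k)$. - $\mathsf{Enc}_{pk}(m)=(0,c_1,\dots,c_k)$ with $c_i=\Pi_i.\mathsf{Enc}_{pk_i}(m)$. - $\mathsf{CondEnc}_{pk}((0,c_1,\dots,c_k),m',m'')=(1,\tilde c_1,\dots,\tilde c_k)$ with $\tilde c_i=\Pi_i.\mathsf{CondEnc}_{pk_i}(c_i,m',m'')$, computed with independent coins; output $\bot$ if some $\tilde c_i=\bot$. - $\mathsf{Dec}_{sk}$: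 decrypt each component with $\Pi_i.\mathsf{Dec}_{sk_i}$ to obtain $m_i\in\mathcal M\cup\{\bot\}$; output $\bot$ if all $m_i=\bot$, otherwise output $m_j$ for the largest $j$ with $m_j\ne\bot$. (By convention $\mathsf{Dec}(\bot)=\bot$.) *)

(* Defs.v *)
From HB Require Import structures.
From mathcomp Require Import all_boot all_order all_algebra.

Set Implicit Arguments.
Unset Strict Implicit.
Unset Printing Implicit Defensive.

Import Order.TTheory GRing.Theory Num.Theory.

Local Open Scope ring_scope.

(* Coins are uniform on a finite type, so product types model independent
   coins. *)
Definition Pr (R : realFieldType) (T : finType) (E : pred T) : R :=
  #|E|%:R / #|T|%:R.

(* The natural number [l] is the security parameter.  A ciphertext is a pair
   (flag, body), flag 0 being [false] and flag 1 being [true]; [None] is the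
   symbol bottom.  [CondEnc] must succeed on honestly generated regular
   ciphertexts, but it may reject a malformed ciphertext that carries flag 0:
   this is needed for the OR-composition, whose regular ciphertexts are tuples
   that may contain components of flag 1. *)
Record condenc (M : eqType) := CondEncScheme {
  kcoin : nat -> finType;
  ecoin : nat -> finType;
  ccoin : nat -> finType;
  skey : nat -> Type;
  pkey : nat -> Type;
  body : nat -> Type;
  KeyGen : forall l, kcoin l -> skey l * pkey l;
  Enc : forall l, pkey l -> M -> ecoin l -> bool * body l;
  CondEnc : forall l,
    pkey l -> bool * body l -> M -> M -> ccoin l -> option (bool * body l);
  Dec : forall l, skey l -> bool * body l -> option M;
  kcoin_gt0 : forall l, (0 < #|kcoin l|)%N;
  ecoin_gt0 : forall l, (0 < #|ecoin l|)%N;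
  ccoin_gt0 : forall l, (0 < #|ccoin l|)%N;
  Enc_flag : forall l (pk : pkey l) m r, (Enc pk m r).1 = false;
  CondEnc_flag : forall l (pk : pkey l) c m2 m3 r c',
    CondEnc pk c m2 m3 r = Some c' -> c.1 = false /\ c'.1 = true;
  CondEnc_Enc : forall l (r1 : kcoin l) m1 r2 m2 m3 r3,
    let pk := (KeyGen r1).2 in CondEnc pk (Enc pk m1 r2) m2 m3 r3
}.

Definition ctxt (M : eqType) (S : condenc M) (l : nat) : Type :=
  (bool * body S l)%type.

(* [Dec] extended by Dec(bottom) = bottom. *)
Definition DecO (M : eqType) (S : condenc M) (l : nat) (sk : skey S l)
    (c : option (ctxt S l)) : option M :=
  obind (@Dec M S l sk) c.

Definition correct (R : realFieldType) (M : eqType) (P : rel M)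
    (S : condenc M) (eps : nat -> R) : Prop :=
  forall (l : nat) (r1 : kcoin S l) (r2 : ecoin S l),
    let sk := (KeyGen r1).1 in
    let pk := (KeyGen r1).2 in
    (forall m : M, Dec sk (Enc pk m r2) = Some m) /\
    (forall m1 m2 m3 : M, P m1 m2 ->
       1 - eps l <= Pr R [pred r3 : ccoin S l |
         DecO sk (CondEnc pk (Enc pk m1 r2) m2 m3 r3) == Some m3]).

Definition error_detecting (R : realFieldType) (M : eqType) (P : rel M)
    (S : condenc M) (eps : nat -> R) : Prop :=
  forall (l : nat) (r1 : kcoin S l) (r2 : ecoin S l),
    let sk := (KeyGen r1).1 in
    let pk := (KeyGen r1).2 in
    forall m1 m2 m3 : M, ~~ P m1 m2 ->
      1 - eps l <= Pr R [pred r3 : ccoin S l |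
        DecO sk (CondEnc pk (Enc pk m1 r2) m2 m3 r3) == None].

Definition some_val (T : Type) (x : option T) : x -> T :=
  match x with
  | Some y => fun=> y
  | None => fun h => False_rect T (notF h)
  end.

Lemma some_valE (T : Type) (x : option T) (h : x) : x = Some (some_val h).
Proof. by case: x h. Qed.

(* A family of optional values, none of them bottom, as an optional family. *)
Definition opt_all (I : finType) (T : I -> Type) (f : forall i, option (T i)) :
    option (forall i, T i) :=
  match @idP [forall i, f i] with
  | ReflectT h => Some (fun i => some_val (forallP h i))
  | ReflectF _ => None
  end.

Lemma opt_all_Some (I : finType) (T : I -> Type)
    (f : forall i, option (T i)) (g : forall i, T i) :
  opt_all f = Some g -> forall i, f i = Some (g i).
Proof.
rewrite /opt_all; case: {-}_ / idP => // h [<-] i; exact: some_valE.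
Qed.

Lemma isSome_opt_all (I : finType) (T : I -> Type)
    (f : forall i, option (T i)) : opt_all f = [forall i, f i] :> bool.
Proof. by rewrite /opt_all; case: {-}_ / idP => [h|/negP/negbTE]. Qed.

(* The entry of largest index different from bottom; bottom if there is none. *)
Definition last_some (k : nat) (T : Type) (m : 'I_k -> option T) : option T :=
  if [pick j | m j && [forall i : 'I_k, (j < i)%N ==> ~~ m i]] is Some j
  then m j else None.

Definition P_or (M : eqType) (k : nat) (P : 'I_k -> rel M) : rel M :=
  fun m1 m2 => [exists i, P i m1 m2].

Section OrComposition.

Variables (M : eqType) (k : nat) (S : 'I_k -> condenc M).

Definition or_kcoin (l : nat) : finType := {dffun forall i, kcoin (S i) l}.
Definition or_ecoin (l : nat) : finType := {dffun forall i, ecoin (S i) l}.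
Definition or_ccoin (l : nat) : finType := {dffun forall i, ccoin (S i) l}.
Definition or_skey (l : nat) : Type := forall i, skey (S i) l.
Definition or_pkey (l : nat) : Type := forall i, pkey (S i) l.
(* The components are ciphertexts, with their own flags. *)
Definition or_body (l : nat) : Type := forall i, ctxt (S i) l.

Definition or_KeyGen l (r : or_kcoin l) : or_skey l * or_pkey l :=
  (fun i => (KeyGen (r i)).1, fun i => (KeyGen (r i)).2).

Definition or_Enc l (pk : or_pkey l) (m : M) (r : or_ecoin l) :
    bool * or_body l :=
  (false, fun i => Enc (pk i) m (r i)).

Definition or_CondEnc l (pk : or_pkey l) (c : bool * or_body l) (m' m'' : M)
    (r : or_ccoin l) : option (bool * or_body l) :=
  if c.1 then None else
  omap (pair true) (opt_all (fun i => CondEnc (pk i) (c.2 i) m' m'' (r i))).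

Definition or_Dec l (sk : or_skey l) (c : bool * or_body l) : option M :=
  last_some (fun i => Dec (sk i) (c.2 i)).

Lemma dffun_gt0 (T : 'I_k -> finType) :
  (forall i, 0 < #|T i|)%N -> (0 < #|{dffun forall i, T i}|)%N.
Proof.
move=> T_gt0; apply/card_gt0P.
by exists (finfun (fun i => enum_val (Ordinal (T_gt0 i)))).
Qed.

Lemma or_CondEnc_flag l (pk : or_pkey l) c m2 m3 r c' :
  or_CondEnc pk c m2 m3 r = Some c' -> c.1 = false /\ c'.1 = true.
Proof.
by rewrite /or_CondEnc; case: c.1 => //; case: opt_all => // g [<-].
Qed.

Lemma or_CondEnc_Enc l (r1 : or_kcoin l) m1 r2 m2 m3 r3 :
  let pk := (or_KeyGen r1).2 in or_CondEnc pk (or_Enc pk m1 r2) m2 m3 r3.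
Proof.
rewrite /or_CondEnc /=.
set o := opt_all _; have : o by rewrite isSome_opt_all; apply/forallP => i; exact: CondEnc_Enc.
by case: o.
Qed.

Definition or_scheme : condenc M :=
  @CondEncScheme M or_kcoin or_ecoin or_ccoin or_skey or_pkey or_body
    or_KeyGen or_Enc or_CondEnc or_Dec
    (fun l => dffun_gt0 (fun i => kcoin_gt0 (S i) l))
    (fun l => dffun_gt0 (fun i => ecoin_gt0 (S i) l))
    (fun l => dffun_gt0 (fun i => ccoin_gt0 (S i) l))
    (fun _ _ _ _ => erefl) or_CondEnc_flag or_CondEnc_Enc.

End OrComposition.

(* Main.v *)
(** Fix the keys and the regular ciphertext.  If every component [i] with
    [P i m1 m2] decrypts to the payload and every other component decrypts to
    bottom, then the OR-composition decrypts correctly.  The components use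
    independent coins, so this has probability [\prod_i p i], where [p i] is the
    probability of the event for component [i], and
    [\prod_i p i >= 1 - \sum_i (1 - p i)].  Here [1 - p i] is at most [eps i] or
    [eps' i] according to [P i m1 m2]. *)

Require Import Defs.
From HB Require Import structures.
From mathcomp Require Import all_boot all_order all_algebra.
From mathcomp Require Import lra.

Set Implicit Arguments.
Unset Strict Implicit.
Unset Printing Implicit Defensive.

Import Order.TTheory GRing.Theory Num.Theory.

Local Open Scope ring_scope.

Lemma eq_last_some (k : nat) (T : Type) (m n : 'I_k -> option T) :
  m =1 n -> last_some m = last_some n.
Proof.
move=> mn; rewrite /last_some.
rewrite (@eq_pick _ _ [pred j | n j & [forall i : 'I_k, (j < i)%N ==> ~~ n i]]).
  by case: pickP.
by move=> j /=; rewrite mn; congr andb; apply: eq_forallb => i; rewrite mn.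
Qed.

Lemma last_some_None (k : nat) (T : Type) (m : 'I_k -> option T) :
  (forall i, m i = None) -> last_some m = None.
Proof. by rewrite /last_some; case: pickP. Qed.

Lemma last_some_Some (k : nat) (T : Type) (m : 'I_k -> option T) x (i0 : 'I_k) :
  m i0 -> (forall i, m i -> m i = Some x) -> last_some m = Some x.
Proof.
move=> mi0 mx; rewrite /last_some; case: pickP => [j /andP[/mx]//|].
(* If [pick] found nothing, the largest [j] with [m j] different from bottom, which exists because
   of [i0], would give a contradiction. *)
case: (@arg_maxnP _ i0 (fun i => m i) val mi0) => j mj jmax /(_ j) /=.
rewrite mj => /negbT /forallPn[i]; rewrite negb_imply negbK => /andP[ji /jmax].
by rewrite /= leqNgt ji.
Qed.

(** One rejecting component would turn the left side into bottom while the right side could still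
    find a message, hence the hypothesis; honest ciphertexts satisfy it by [CondEnc_Enc]. *)
Lemma DecO_or_CondEnc (M : eqType) (k : nat) (S : 'I_k -> condenc M) (l : nat)
    (sk : or_skey S l) (pk : or_pkey S l) (c : or_body S l) m2 m3
    (r : or_ccoin S l) :
  (forall i, CondEnc (pk i) (c i) m2 m3 (r i)) ->
  @DecO _ (or_scheme S) l sk (@CondEnc _ (or_scheme S) l pk (false, c) m2 m3 r) =
  last_some (fun i => DecO (sk i) (CondEnc (pk i) (c i) m2 m3 (r i))).
Proof.
move=> ok; rewrite /= /or_CondEnc /=.
case og: opt_all => [g|]; first last.
  have := isSome_opt_all (fun i => CondEnc (pk i) (c i) m2 m3 (r i)).
  by rewrite og => /esym/forallP[].
by apply: eq_last_some => i; rewrite (opt_all_Some og).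
Qed.

Lemma prod_ge_sub_sum (R : realFieldType) (I : finType) (p : I -> R) :
  (forall i, 0 <= p i <= 1) -> 1 - \sum_i (1 - p i) <= \prod_i p i.
Proof.
(* The bounds on [y] make the invariant multiplicative: [(1 - y) * (1 - y') >= 0] gives
   [y * y' >= y + y' - 1]. *)
move=> p01; pose K (x y : R) := 0 <= y <= 1 /\ 1 - x <= y.
suff: K (\sum_i (1 - p i)) (\prod_i p i) by case.
apply: (big_ind2 K) => [|x1 x2 y1 y2|i _]; rewrite /K.
- by rewrite ler01 lexx subr0.
- by move=> [/andP[? ?] ?] [/andP[? ?] ?]; split; [apply/andP; split|]; nra.
- by split=> //; rewrite opprB addrC subrK.
Qed.

(** [E] contains the box [family A], whose cardinality is the product of those of the [A i]; this is
    where independence of the coins enters. *)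
Lemma Pr_dffun_ge (R : realFieldType) (I : finType) (T : I -> finType)
    (A : forall i, pred (T i)) (e : I -> R)
    (E : pred {dffun forall i, T i}) :
  (forall i, 0 < #|T i|)%N ->
  (forall i, 1 - e i <= Pr R (A i)) ->
  (forall f : {dffun forall i, T i}, (forall i, A i (f i)) -> E f) ->
  1 - \sum_i e i <= Pr R E.
Proof.
move=> T_gt0 Ae AE.
have T0 i : 0 < #|T i|%:R :> R by rewrite ltr0n.
apply: (@le_trans _ _ (\prod_i Pr R (A i))).
  apply: le_trans (prod_ge_sub_sum _) => [|i].
    by rewrite lerB// ler_sum// => i _; rewrite lerBlDr -lerBlDl.
  by rewrite divr_ge0 ?ler0n//= ler_pdivrMr// mul1r ler_nat max_card.
rewrite /Pr big_split/= prodfV -!natr_prod.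
have -> : (\prod_i #|A i|)%N =
    #|(family A : simpl_pred {dffun forall i, T i})|.
  by rewrite card_family foldrE big_map big_enum.
have -> : (\prod_i #|T i|)%N = #|{dffun forall i, T i}|.
  by rewrite card_dep_ffun foldrE big_map big_enum.
rewrite ler_wpM2r ?invr_ge0 ?ler0n// ler_nat.
by apply/subset_leq_card/subsetP => f /familyP fA; apply: AE.
Qed.

Theorem theorem8 (R : realFieldType) (M : eqType) (k : nat)
    (P : 'I_k -> rel M) (S : 'I_k -> condenc M)
    (eps eps' : 'I_k -> nat -> R)
    (k_gt0 : (0 < k)%N)
    (eps_ge0 : forall i l, 0 <= eps i l)
    (eps'_ge0 : forall i l, 0 <= eps' i l)
    (S_correct : forall i, correct (P i) (S i) (eps i))
    (S_detecting : forall i, error_detecting (P i) (S i) (eps' i)) :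
  correct (P_or P) (or_scheme S)
    (fun l => \sum_(i < k) eps' i l + \sum_(i < k) eps i l) /\
  error_detecting (P_or P) (or_scheme S)
    (fun l => \sum_(i < k) eps' i l).
Proof.
have decE l (r1 : kcoin (or_scheme S) l) (r2 : ecoin (or_scheme S) l) m1 m2 m3
    (r3 : ccoin (or_scheme S) l) :
    let sk := (KeyGen r1).1 in let pk := (KeyGen r1).2 in
    DecO sk (CondEnc pk (Enc pk m1 r2) m2 m3 r3) =
    last_some (fun i => DecO (KeyGen (r1 i)).1
      (CondEnc (KeyGen (r1 i)).2 (Enc (KeyGen (r1 i)).2 m1 (r2 i)) m2 m3 (r3 i))).
  by move=> sk pk; apply: DecO_or_CondEnc => i; apply: CondEnc_Enc.
split=> l r1 r2 sk pk; [split=> [m|m1 m2 m3 /existsP[i0 Pi0]]|move=> m1 m2 m3 nP].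
- have dec i : Dec (sk i) (Enc (pk i) m (r2 i)) = Some m.
    by have [->] := S_correct i l (r1 i) (r2 i).
  (* [k_gt0] provides a component that is not bottom. *)
  by apply: (@last_some_Some _ _ _ _ (Ordinal k_gt0)) => [|i _]; rewrite /= dec.
- pose e i := if P i m1 m2 then eps i l else eps' i l.
  apply: (@le_trans _ _ (1 - \sum_i e i)).
    (* Each [e i] is one of [eps i l] and [eps' i l]; as the other is nonnegative, their sum bounds
       it. *)
    rewrite lerB// -big_split ler_sum// => i _; rewrite /e /=.
    by case: ifP => _; rewrite ?lerDl ?lerDr.
  apply: (@Pr_dffun_ge _ _ _ (fun i => [pred r : ccoin (S i) l |
      DecO (KeyGen (r1 i)).1 (CondEnc (KeyGen (r1 i)).2
        (Enc (KeyGen (r1 i)).2 m1 (r2 i)) m2 m3 r)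
      == if P i m1 m2 then Some m3 else None])) => [i|i|r3 Ar3].
  + exact: ccoin_gt0.
  + rewrite /e; case: ifPn => Pi; last exact: S_detecting.
    by have [_] := S_correct i l (r1 i) (r2 i); apply.
  (* Component [i0] yields [m3], and any other component that is not bottom yields [m3] too, so the
     choice of the last one is harmless. *)
  + rewrite inE decE; apply/eqP/(@last_some_Some _ _ _ _ i0) => [|i].
      by have /eqP-> := Ar3 i0; rewrite Pi0.
    by have /eqP-> := Ar3 i; case: ifP.
(* Now every [P i m1 m2] fails, so only the errors [eps'] occur. *)
- apply: (@Pr_dffun_ge _ _ _ (fun i => [pred r : ccoin (S i) l |
      DecO (KeyGen (r1 i)).1 (CondEnc (KeyGen (r1 i)).2
        (Enc (KeyGen (r1 i)).2 m1 (r2 i)) m2 m3 r) == None])) => [i|i|r3 Ar3].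
  + exact: ccoin_gt0.
  + by apply: S_detecting; move: nP; rewrite negb_exists => /forallP.
  + by rewrite inE decE; apply/eqP/last_some_None => i; apply/eqP/Ar3.
Qed.
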